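(* Let $\mathcal P$ be a collection of probability measures on a measurable space $(\Omega,\mathcal F)$, and let $(X_n)_{n=1}^\infty$ be random variables on $(\Omega,\mathcal F)$ that are independent under every $P\in\mathcal P$. If $$\lim_{m\to\infty}\sup_{P\in\mathcal P}\sum_{k=m}^\infty\mathrm{Var}_P(X_k)=0,$$ then the sequence $S_n:=\sum_{i=1}^n(X_i-\mathbb E_P(X_i))$ is $\mathcal P$-uniformly Cauchy.
   Context: $\mathbb E_P$ and $\mathrm{Var}_P$ denote expectation and variance under $P$; it is understood that $\mathbb E_P(X_i)$ is well defined and finite for every $i$ and $P$. A sequence $(Y_n)_{n=1}^\infty$ of random variables (where $Y_n=Y_n(P)$ may depend on $P$, as $S_n$ does here through its centering) is $\mathcal P$-uniformly Cauchy if for every $\varepsilon>0$, $$\lim_{m\to\infty}\sup_{P\in\mathcal P}P\left(\sup_{k,n\ge m}|Y_k-Y_n|\ge\varepsilon\right)=0.$$ *)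

(* Defs.v *)
(* MathComp-Analysis *)
From mathcomp Require Export all_boot all_order all_algebra.
From mathcomp Require Export finmap.
From mathcomp Require Export all_classical all_reals all_analysis.

Set Implicit Arguments.
Unset Strict Implicit.
Unset Printing Implicit Defensive.

Import Order.TTheory GRing.Theory Num.Theory.
Import numFieldNormedType.Exports.

Local Open Scope classical_set_scope.
Local Open Scope ring_scope.

(* Mutual (not merely pairwise) independence. *)
Definition independent_rvs (d : measure_display) (T : measurableType d)
    (R : realType) (P : probability T R) (I : choiceType)
    (X : I -> {mfun T >-> R}) : Prop :=
  forall (J : {fset I}) (B : I -> set R),
    (forall i, measurable (B i)) ->
    P (\bigcap_(i in [set` J]) (X i @^-1` B i)) =
    (\prod_(i <- J) P (X i @^-1` B i))%E.

(* The inner supremum is taken in the extended reals because it may be +oo.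
   Y may depend on the measure. *)
Definition uniformly_cauchy (d : measure_display) (T : measurableType d)
    (R : realType) (PP : set (probability T R))
    (Y : probability T R -> nat -> T -> R) : Prop :=
  forall eps : R, 0 < eps ->
    ereal_sup [set P [set w | (eps%:E <=
        ereal_sup [set `|Y P k w - Y P n w|%:E
                  | k in [set k | (m <= k)%N] & n in [set n | (m <= n)%N]])%E]
      | P in PP] @[m --> \oo] --> 0%E.

(* Sequences are indexed from 0: X i and centered_sum X P n stand for
   X_(i+1) and S_(n+1), so that centered_sum X P n has n+1 terms. *)
Definition centered_sum (d : measure_display) (T : measurableType d)
    (R : realType) (X : nat -> {mfun T >-> R}) (P : probability T R)
    (n : nat) (w : T) : R :=
  \sum_(i < n.+1) (X i w - fine 'E_P[X i]).

(* Main.v *)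
Require Import Defs.
From mathcomp Require Import all_boot all_order all_algebra.
From mathcomp Require Import finmap.
From mathcomp Require Import all_classical all_reals all_analysis.
From mathcomp Require Import measurable_realfun.
From mathcomp Require Import lra ring.

Import Order.TTheory GRing.Theory Num.Theory.
Import numFieldNormedType.Exports.

Set Implicit Arguments.
Unset Strict Implicit.

Local Open Scope classical_set_scope.
Local Open Scope ring_scope.

(** The oscillation of the centered sums beyond time [m] is controlled by
    Kolmogorov's maximal inequality, whose bound is distribution free: under
    every single measure, with [Y i = X i - E (X i)],
      P (some |Y m + ... + Y (m + k - 1)| >= e) <= e^-2 * sum_(k >= m) Var (X k)
    ([kolmogorov_maximal_tail]).  If all these partial sums stay below [eps / 3],
    then any two centered sums beyond time [m] differ by at most [2 * eps / 3],
    so their oscillation is smaller than [eps] ([oscillation_sub_maximal]).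
    Taking the supremum over the measures on both sides leaves the assumption on
    the tails of the variances.

    The maximal inequality itself is obtained by stopping.  Take [m = 0] to
    lighten the notation, and let [W] be the walk with steps [Y 0], [Y 1], ...
    frozen as soon as its absolute value reaches [eps].  If the unstopped walk
    reaches level [eps] by time [n], then [|W n| >= eps] ([stopped_walk_reaches]), so that the maximal event
    has probability at most [E (W n)^2 / eps^2] by Markov's inequality.  A step
    changes the square by
      W (n+1)^2 = W n^2 + 2 * Z n * Y n + 1_(|W n| < eps) * (Y n)^2,
    where [Z n = W n * 1_(|W n| < eps)].  The cross term has mean zero, because
    [Z n] depends on the past only and is thus independent of the centered
    variable [Y n] ([truncated_walk_orthogonal]); hence [E (W n)^2] is at most
    the sum of the variances ([stopped_walk_second_moment]).  Since [Z n] is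
    bounded, the cross term is integrable as soon as [Y n] is.

    Independence is used in a single form: the sigma-algebra generated by the
    variables before time [n] is independent of the n-th one
    ([independent_past], a pi-lambda argument), which gives product expectations
    through Fubini's theorem ([expectation_prod_indep]). *)

(** * Independence from the past *)

(** Finite intersections of preimages rather than preimages of single variables:
    they generate the same sigma-algebra, that of the variables before time [n],
    and are closed under intersection, as uniqueness of measures requires. *)
Definition past_cylinder (d : measure_display) (T : measurableType d)
    (R : realType) (X : nat -> {mfun T >-> R}) (n : nat) : set (set T) :=
  [set A | exists2 B : nat -> set R, (forall i, measurable (B i)) &
     A = \bigcap_(i in `I_n) X i @^-1` B i].

Lemma setI_closed_past_cylinder (d : measure_display) (T : measurableType d)
    (R : realType) (X : nat -> {mfun T >-> R}) (n : nat) :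
  setI_closed (past_cylinder X n).
Proof.
move=> _ _ [B mB ->] [C mC ->]; exists (fun i => B i `&` C i).
  by move=> i; exact: measurableI.
by rewrite -bigcapI.
Qed.

Lemma measurable_past_cylinder (d : measure_display) (T : measurableType d)
    (R : realType) (X : nat -> {mfun T >-> R}) (n : nat) :
  past_cylinder X n `<=` measurable.
Proof.
move=> _ [B mB ->]; apply: bigcap_measurableType => i _.
exact: measurable_funPTI.
Qed.

(** Both sides, as functions of [A], are finite measures; independence says that
    they agree on the pi-system of past cylinders, hence they agree on the
    sigma-algebra that it generates. *)
Lemma independent_past (d : measure_display) (T : measurableType d)
    (R : realType) (P : probability T R) (X : nat -> {mfun T >-> R}) (n : nat)
    (A : set T) (B : set R) :
  independent_rvs P X -> <<s past_cylinder X n >> A -> measurable B ->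
  P (A `&` X n @^-1` B) = (P A * P (X n @^-1` B))%E.
Proof.
move=> indX pA mB.
have mXB : measurable (X n @^-1` B) by exact: measurable_funPTI.
pose c : {nonneg R} := NngNum (fine_ge0 (measure_ge0 P (X n @^-1` B))).
have traceT : [set U | past_cylinder X n U /\ U `<=` setT] = past_cylinder X n.
  by apply/seteqP; split => [U []|U].
have cylE U : past_cylinder X n U ->
    mrestr P mXB U = mscale c P U.
  move=> [C mC ->]; rewrite /mrestr /mscale/= fineK ?fin_num_measure//.
  (* a cylinder with [B] imposed at time n is a cylinder of length n.+1 *)
  pose C' i := if (i < n)%N then C i else B.
  have mC' i : measurable (C' i) by rewrite /C'; case: ifP.
  have prodE k : P (\bigcap_(i in `I_k) X i @^-1` C' i) =
      (\prod_(i < k) P (X i @^-1` C' i))%E.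
    have := indX [fset i | i in index_iota 0 k]%fset C' mC'.
    rewrite big_imfset//= undup_id ?iota_uniq// big_mkord => <-; congr (P _).
    congr bigcap; apply/seteqP; split => i /=.
      by move=> ltik; rewrite in_fset /= mem_index_iota.
    by rewrite in_fset /= mem_index_iota.
  have C'n : C' n = B by rewrite /C' ltnn.
  have C'lt : \bigcap_(i in `I_n) X i @^-1` C' i =
      \bigcap_(i in `I_n) X i @^-1` C i.
    by apply: eq_bigcapr => i /= ltin; rewrite /C' ltin.
  have := prodE n.+1; rewrite big_ord_recr/= -prodE C'lt C'n muleC => <-.
  by rewrite IIS bigcap_setU bigcap_set1 C'n C'lt.
have : mrestr P mXB A = mscale c P A.
  apply: (g_sigma_algebra_measure_unique_trace (past_cylinder X n) setT);
    rewrite ?traceT//.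
  - exact: measurable_past_cylinder.
  - exact: setI_closed_past_cylinder.
  - apply: cylE; exists (fun=> setT) => //.
    by apply/seteqP; split.
  - by rewrite /= /mrestr setTI (le_lt_trans (probability_le1 _ _))// ltry.
by rewrite /mrestr /mscale/= fineK ?fin_num_measure// muleC.
Qed.

(** Measurability with respect to the past, on a copy of the sample space that
    carries the sigma-algebra generated by the past cylinders: the ordinary
    closure properties of measurable functions then show that a function of
    the past is measurable with respect to it. *)
Lemma measurable_past (d : measure_display) (T : measurableType d)
    (R : realType) (X : nat -> {mfun T >-> R}) (n i : nat) :
  (i < n)%N ->
  measurable_fun [set: g_sigma_algebraType (past_cylinder X n)] (X i).
Proof.
move=> ltin _ B mB; rewrite setTI; apply: sub_sigma_algebra.
exists (fun j => if j == i then B else setT) => [j|]; first by case: ifP.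
apply/seteqP; split => [w XB j /= ltjn|w /(_ i ltin)/=].
  by case: eqP => [->|].
by rewrite eqxx.
Qed.

Lemma expectation_integral (d : measure_display) (T : measurableType d)
    (R : realType) (P : probability T R) (f : T -> R) :
  ('E_P[f] = \int[P]_w (f w)%:E)%E.
Proof. by rewrite unlock. Qed.

(** Independence identifies the law of the pair [(Z, Y)] with the product of the
    two laws, under which the integral of [x * y] factors by Fubini's theorem. *)
Lemma expectation_prod_indep (d : measure_display) (T : measurableType d)
    (R : realType) (P : probability T R) (Z Y : T -> R) :
  P.-integrable setT (EFin \o Z) -> P.-integrable setT (EFin \o Y) ->
  P.-integrable setT (EFin \o (Z \* Y)) ->
  (forall A B : set R, measurable A -> measurable B ->
     P (Z @^-1` A `&` Y @^-1` B) = (P (Z @^-1` A) * P (Y @^-1` B))%E) ->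
  ('E_P[Z \* Y] = 'E_P[Z] * 'E_P[Y])%E.
Proof.
move=> iZ iY iZY ind.
have mZ : measurable_fun setT Z.
  by apply/measurable_EFinP; exact: measurable_int iZ.
have mY : measurable_fun setT Y.
  by apply/measurable_EFinP; exact: measurable_int iY.
pose Z' : {mfun T >-> R} := mfun_Sub (mem_set mZ).
pose Y' : {mfun T >-> R} := mfun_Sub (mem_set mY).
pose V : {mfun T >-> (R * R)%type} :=
  mfun_Sub (mem_set (measurable_fun_pair mZ mY)).
pose f (z : R * R) := (z.1 * z.2)%:E.
have mf : measurable_fun setT f.
  by apply/measurable_EFinP; exact: measurable_funM.
have jointE U : measurable U ->
    (distribution P Z' \x distribution P Y')%E U = distribution P V U.
  apply: product_measure_unique => A B mA mB.
  by rewrite /distribution/= /pushforward -ind.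
have iV : (distribution P V).-integrable setT f.
  by apply: integrable_pushforward.
have iprod : (distribution P Z' \x distribution P Y')%E.-integrable setT f.
  apply/integrableP; split => //.
  rewrite (eq_measure_integral (distribution P V)) => [|A mA _].
    by case/integrableP : iV.
  exact: jointE.
rewrite !expectation_integral.
transitivity (\int[distribution P V]_z f z)%E.
  by rewrite integral_distribution.
rewrite -(eq_measure_integral _ (fun A mA _ => jointE A mA)).
rewrite -integral12_prod_meas1// /fubini_F/=.
have [m mE] : exists m : R, (\int[P]_w (Y w)%:E = m%:E)%E.
  by exists (fine (\int[P]_w (Y w)%:E)); rewrite fineK// integrable_fin_num.
have EY x : (\int[distribution P Y']_y f (x, y) = (x * m)%:E)%E.
  rewrite /f/= integral_distribution//=.
  - under eq_integral do rewrite EFinM.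
    by rewrite integralZl// mE.
  - by apply/measurable_EFinP; exact: measurable_funM.
  - by under [X in _.-integrable _ X]eq_fun do rewrite /= EFinM;
      exact: integrableZl.
under eq_integral do rewrite EY.
rewrite integral_distribution//=.
- rewrite mE; under eq_integral do rewrite EFinM.
  by rewrite integralZr.
- by apply/measurable_EFinP; exact: measurable_funM.
- by under [X in _.-integrable _ X]eq_fun do rewrite /= EFinM;
    exact: integrableZr.
Qed.

(** * The walk stopped at a level *)

Fixpoint stopped_walk (T : Type) (R : realType) (Y : nat -> T -> R) (eps : R)
    (n : nat) (w : T) : R :=
  if n is k.+1 then
    let s := stopped_walk Y eps k w in s + (if `|s| < eps then Y k w else 0)
  else 0.

(** At the first time the partial sums reach level [eps], the stopped walk still
    agrees with them, and it does not move afterwards. *)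
Lemma stopped_walk_reaches (T : Type) (R : realType) (Y : nat -> T -> R)
    (eps : R) (n : nat) (w : T) :
  (exists2 k, (k <= n)%N & eps <= `|\sum_(i < k) Y i w|) ->
  eps <= `|stopped_walk Y eps n w|.
Proof.
have agree k : (forall j, (j < k)%N -> `|\sum_(i < j) Y i w| < eps) ->
    stopped_walk Y eps k w = \sum_(i < k) Y i w.
  elim: k => [|k IH] small; first by rewrite big_ord0.
  rewrite big_ord_recr/= IH => [|j ltjk]; last by apply: small; rewrite ltnS ltnW.
  by rewrite small.
have frozen k j : eps <= `|stopped_walk Y eps k w| -> 
    stopped_walk Y eps (k + j) w = stopped_walk Y eps k w.
  move=> epsk; elim: j => [|j IH]; first by rewrite addn0.
  by rewrite addnS/= IH ltNge epsk addr0.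
case=> k0 lek0n epsk0.
have ex : exists k, eps <= `|\sum_(i < k) Y i w| by exists k0.
case: (ex_minnP ex) => k epsk kmin.
have walk_k : stopped_walk Y eps k w = \sum_(i < k) Y i w.
  apply: agree => j ltjk; rewrite ltNge; apply/negP => /kmin.
  by rewrite leqNgt ltjk.
rewrite -(subnKC (leq_trans (kmin _ epsk0) lek0n)) frozen walk_k//.
Qed.

Lemma measurable_stopped_walk (d : measure_display) (T : measurableType d)
    (R : realType) (Y : nat -> T -> R) (eps : R) (n : nat) :
  (forall k, (k < n)%N -> measurable_fun setT (Y k)) ->
  measurable_fun setT (stopped_walk Y eps n).
Proof.
elim: n => [|n IH] mY; first exact: measurable_cst.
have mW : measurable_fun setT (stopped_walk Y eps n).
  by apply: IH => k ltkn; apply: mY; rewrite ltnS ltnW.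
apply: measurable_funD => //; apply: measurable_fun_ifT => //; last exact: mY.
apply: measurable_fun_ltr => //.
exact: measurableT_comp.
Qed.

(** The factor multiplying the n-th step in the expansion of the square of the
    stopped walk at time [n.+1]. *)
Definition truncated_walk (T : Type) (R : realType) (Y : nat -> T -> R)
    (eps : R) (n : nat) (w : T) : R :=
  if `|stopped_walk Y eps n w| < eps then stopped_walk Y eps n w else 0.

Lemma measurable_truncated_walk (d : measure_display) (T : measurableType d)
    (R : realType) (Y : nat -> T -> R) (eps : R) (n : nat) :
  (forall k, (k < n)%N -> measurable_fun setT (Y k)) ->
  measurable_fun setT (truncated_walk Y eps n).
Proof.
move=> mY; have mW := measurable_stopped_walk eps mY.
apply: measurable_fun_ifT => //; apply: measurable_fun_ltr => //.
exact: measurableT_comp.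
Qed.

Lemma bounded_truncated_walk (T : Type) (R : realType) (Y : nat -> T -> R)
    (eps : R) (n : nat) :
  [bounded truncated_walk Y eps n w | w in [set: T]].
Proof.
exists `|eps|; split; first exact: num_real.
move=> M ltM w _; apply: (le_trans _ (ltW ltM)); rewrite /= /truncated_walk.
case: ifP => [/ltW|_]; last by rewrite normr0.
by move=> /le_trans; apply; exact: ler_norm.
Qed.

(** Stopping can only lower the second moment: expanding the square of a step,
    the cross terms vanish by orthogonality and the squares of the suppressed
    steps are missing.  Integrability is carried along the induction to split
    the integral. *)
Lemma stopped_walk_second_moment (d : measure_display) (T : measurableType d)
    (R : realType) (P : probability T R) (Y : nat -> T -> R) (eps : R)
    (n : nat) :
  (forall k, (k < n)%N -> P.-integrable setT (EFin \o Y k)) ->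
  (forall k, (k < n)%N -> P.-integrable setT (EFin \o (Y k \* Y k))) ->
  (forall k, (k < n)%N -> ('E_P[truncated_walk Y eps k \* Y k] = 0)%E) ->
  let W := stopped_walk Y eps n in
  P.-integrable setT (EFin \o (W \* W)) /\
  ('E_P[W \* W] <= \sum_(k < n) 'E_P[Y k \* Y k])%E.
Proof.
rewrite /=; elim: n => [|n IH] iY iYY orth.
  rewrite expectation_integral big_ord0 /=.
  under [X in _.-integrable _ X]eq_fun do rewrite /= mul0r.
  under eq_integral do rewrite mul0r.
  by rewrite integral0; split => //; exact: integrable0.
have [||| iWW leWW] := IH; [by move=> k /ltnW; auto ..|].
set W := stopped_walk Y eps n in iWW leWW *.
set Z := truncated_walk Y eps n.
pose Q w := if `|W w| < eps then Y n w * Y n w else 0.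
have mY k : (k < n.+1)%N -> measurable_fun setT (Y k).
  by move=> /iY/measurable_int/measurable_EFinP.
have mW : measurable_fun setT W.
  by apply: measurable_stopped_walk => k /ltnW; exact: mY.
have mZ : measurable_fun setT Z.
  by apply: measurable_truncated_walk => k /ltnW; exact: mY.
have iZY : P.-integrable setT (EFin \o (Z \* Y n)).
  have := integrableMr measurableT mZ (bounded_truncated_walk Y eps n)
    (iY n (ltnSn n)).
  by apply: eq_integrable.
have mQ : measurable_fun setT Q.
  apply: measurable_fun_ifT => //.
    by apply: measurable_fun_ltr => //; exact: measurableT_comp.
  by apply: measurable_funM; exact: mY.
have iQ : P.-integrable setT (EFin \o Q).
  apply: le_integrable (iYY n (ltnSn n)) => //; first exact/measurable_EFinP.
  move=> w _; rewrite /= lee_fin /Q; case: ifP => // _.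
  by rewrite normr0.
have leQ : (\int[P]_w (Q w)%:E <= \int[P]_w (Y n w * Y n w)%:E)%E.
  apply: ge0_le_integral => //=.
  - by move=> w _; rewrite lee_fin /Q; case: ifP => // _; rewrite -expr2 sqr_ge0.
  - exact/measurable_EFinP.
  - by apply/measurable_EFinP; apply: measurable_funM; exact: mY.
  - move=> w _; rewrite lee_fin /Q; case: ifP => // _.
    by rewrite -expr2 sqr_ge0.
have i2ZY : P.-integrable setT (EFin \o (fun w => 2 * (Z w * Y n w))).
  by under [X in _.-integrable _ X]eq_fun do rewrite /= EFinM;
    exact: integrableZl.
have -> : stopped_walk Y eps n.+1 \* stopped_walk Y eps n.+1 =
    (fun w => W w * W w + 2 * (Z w * Y n w) + Q w).
  apply/funext => w; rewrite /Z /Q /truncated_walk /= -/W.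
  by case: ifP => _; ring.
have iWZ : P.-integrable setT (EFin \o (fun w => W w * W w + 2 * (Z w * Y n w))).
  by under [X in _.-integrable _ X]eq_fun do rewrite /= EFinD;
    exact: integrableD.
split=> /=.
  by under [X in _.-integrable _ X]eq_fun do rewrite /= EFinD;
    exact: integrableD.
rewrite expectation_integral.
rewrite integralD_EFin// integralD_EFin//=.
under [X in (_ + X + _)%E]eq_integral do rewrite /= EFinM.
rewrite integralZl//.
have := orth n (ltnSn n); rewrite expectation_integral -/Z => ->.
rewrite mule0 adde0 big_ord_recr/= [('E_P[Y n \* Y n])%E]expectation_integral.
by rewrite leeD// -expectation_integral.
Qed.

(** * Kolmogorov's maximal inequality *)

Definition centered (d : measure_display) (T : measurableType d)
    (R : realType) (P : probability T R) (X : nat -> {mfun T >-> R})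
    (i : nat) (w : T) : R := X i w - fine 'E_P[X i].

Section centered_variables.
Context (d : measure_display) (T : measurableType d) (R : realType).
Context (P : probability T R) (X : nat -> {mfun T >-> R}).
Hypothesis iX : forall i, P.-integrable [set: T] (EFin \o X i).

Let Y := centered P X.

Lemma measurable_centered (i : nat) : measurable_fun setT (Y i).
Proof. by apply: measurable_funB. Qed.

Lemma integrable_centered (i : nat) : P.-integrable setT (EFin \o Y i).
Proof.
have -> : EFin \o Y i = ((EFin \o X i) \- cst (fine 'E_P[X i])%:E)%E by [].
by apply: integrableB => //; exact: finite_measure_integrable_cst.
Qed.

Lemma expectation_centered (i : nat) : ('E_P[Y i] = 0)%E.
Proof.
rewrite expectation_integral.
have -> : (fun w => (Y i w)%:E) = ((EFin \o X i) \- cst (fine 'E_P[X i])%:E)%E.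
  by [].
rewrite integralB//; last exact: finite_measure_integrable_cst.
rewrite integral_cst//= probability_setT mule1 expectation_integral.
have fin : (\int[P]_w (X i w)%:E)%E \is a fin_num.
  by apply: integrable_fin_num => //; exact: iX.
by rewrite fineK// subee.
Qed.

Lemma variance_centered (i : nat) : ('V_P[X i] = 'E_P[Y i \* Y i])%E.
Proof. by rewrite /variance unlock. Qed.

Lemma integrable_centered_sqr (i : nat) :
  ('V_P[X i] < +oo)%E -> P.-integrable setT (EFin \o (Y i \* Y i)).
Proof.
rewrite variance_centered expectation_integral => ltoo.
apply/integrableP; split.
  by apply/measurable_EFinP; apply: measurable_funM; exact: measurable_centered.
under eq_integral do rewrite /= ger0_norm -?expr2 ?sqr_ge0//.
exact: ltoo.
Qed.

Hypothesis indX : independent_rvs P X.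

(** The truncated walk is measurable with respect to the variables before time
    [m + k], so it is independent of the centered variable [Y (m + k)]. *)
Lemma truncated_walk_orthogonal (m k : nat) (eps : R) :
  let Y' j := Y (m + j) in
  ('E_P[truncated_walk Y' eps k \* Y' k] = 0)%E.
Proof.
move=> Y'.
pose Z := truncated_walk Y' eps k.
have pastZ : measurable_fun
    [set: g_sigma_algebraType (past_cylinder X (m + k))] Z.
  apply: measurable_truncated_walk => j ltjk; apply: measurable_funB => //.
  by apply: measurable_past; rewrite ltn_add2l.
have mZ : measurable_fun setT Z.
  by apply: measurable_truncated_walk => j _; exact: measurable_centered.
have bZ : [bounded Z w | w in [set: T]] := bounded_truncated_walk Y' eps k.
have iY' := integrable_centered (m + k).
rewrite -[truncated_walk _ _ _]/Z expectation_prod_indep//.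
- by rewrite expectation_centered mule0.
- by apply: measurable_bounded_integrable => //; rewrite /= probability_setT ltry.
- by have := integrableMr measurableT mZ bZ iY'; apply: eq_integrable.
move=> A B mA mB.
have shiftB : Y' k @^-1` B =
    X (m + k) @^-1` ((fun x => x - fine 'E_P[X (m + k)]) @^-1` B).
  by [].
rewrite shiftB; apply: independent_past => //.
  by have := pastZ measurableT A mA; rewrite setTI.
rewrite -[X in measurable X]setTI.
have : measurable_fun setT (fun x : R => x - fine 'E_P[X (m + k)]).
  exact: measurable_funB.
exact.
Qed.

(** Kolmogorov's maximal inequality for the block of variables starting at [m]:
    Markov's inequality for the square of the stopped walk. *)
Lemma kolmogorov_maximal (m n : nat) (eps : R) :
  0 < eps -> (forall k, (k < n)%N -> ('V_P[X (m + k)] < +oo)%E) ->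
  (P (\bigcup_(k in `I_n.+1)
       [set w | (eps <= `|\sum_(i < k) Y (m + i) w|)%R]) <=
   (eps ^- 2)%:E * \sum_(k < n) 'V_P[X (m + k)])%E.
Proof.
move=> eps0 Voo.
pose Y' j := Y (m + j).
pose W := stopped_walk Y' eps n.
have [] := @stopped_walk_second_moment _ _ _ P Y' eps n.
- by move=> k _; exact: integrable_centered.
- by move=> k ltkn; apply: integrable_centered_sqr; exact: Voo.
- by move=> k _; exact: truncated_walk_orthogonal.
move=> _; rewrite -/W => leW.
have mW : measurable_fun setT W.
  by apply: measurable_stopped_walk => k _; exact: measurable_centered.
pose W' : {mfun T >-> R} := mfun_Sub (mem_set mW).
have leP : (P (\bigcup_(k in `I_n.+1)
       [set w | (eps <= `|\sum_(i < k) Y (m + i) w|)%R]) <=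
   P [set w | eps%:E <= `| (W' w)%:E |])%E.
  apply: le_measure; rewrite ?inE.
  - apply: bigcup_measurable => k _; rewrite -[X in measurable X]setTI.
    apply: measurable_fun_le => //; apply: measurableT_comp => //.
    by apply: measurable_sum => i; exact: measurable_centered.
  - rewrite -[X in measurable X]setTI; apply: emeasurable_fun_c_infty => //.
    by apply: measurableT_comp => //; exact/measurable_EFinP.
  - move=> w [k /= lekn epsk]; rewrite lee_fin.
    by apply: stopped_walk_reaches; exists k.
apply: (le_trans leP).
rewrite lee_pdivlMl ?exprn_gt0//.
have sumE : (\sum_(k < n) 'V_P[X (m + k)] = \sum_(k < n) 'E_P[Y' k \* Y' k])%E.
  by apply: eq_bigr => k _; rewrite variance_centered.
have WE : W \* W = ((fun x => x ^+ 2) \o (fun x => `|x|)) \o W'.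
  by apply/funext => w /=; rewrite real_normK ?num_real// expr2.
rewrite sumE; apply: le_trans leW; rewrite WE.
apply: (@markov _ _ _ P W' (fun x => x ^+ 2) eps eps0) => //.
  by move=> r _; exact: sqr_ge0.
by move=> x y; rewrite !nnegrE => x0 y0; rewrite ler_sqr.
Qed.

(** Continuity from below extends the maximal inequality to infinitely many
    partial sums.  If the tail of the variances is infinite the bound is void,
    otherwise each variance is finite. *)
Lemma kolmogorov_maximal_tail (m : nat) (eps : R) :
  0 < eps ->
  (P (\bigcup_k [set w | (eps <= `|\sum_(i < k) Y (m + i) w|)%R]) <=
   (eps ^- 2)%:E * \sum_(m <= k <oo) 'V_P[X k])%E.
Proof.
move=> eps0.
have [->|Vlty] := eqVneq (\sum_(m <= k <oo) 'V_P[X k])%E +oo%E.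
  by rewrite gt0_muley ?leey// lte_fin invr_gt0 exprn_gt0.
have tail_ge n : (\sum_(m <= k < n) 'V_P[X k] <= \sum_(m <= k <oo) 'V_P[X k])%E.
  by apply: nneseries_lim_ge => k _ _; exact: variance_ge0.
have Voo k : ('V_P[X (m + k)] < +oo)%E.
  apply: le_lt_trans (_ : _ < +oo)%E; last by rewrite ltey; exact: Vlty.
  apply: le_trans (tail_ge (m + k).+1).
  rewrite big_nat_recr/= ?leq_addr// leeDr// sume_ge0// => i _.
  exact: variance_ge0.
pose E k := [set w | (eps <= `|\sum_(i < k) Y (m + i) w|)%R].
pose F n := \bigcup_(k in `I_n.+1) E k.
have mE k : measurable (E k).
  rewrite -[X in measurable X]setTI.
  apply: measurable_fun_le => //; apply: measurableT_comp => //.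
  by apply: measurable_sum => i; exact: measurable_centered.
have mF n : measurable (F n) by exact: bigcup_measurable.
have -> : \bigcup_k E k = \bigcup_n F n.
  apply/seteqP; split => [w [k _ Ek]|w [n _ [k _ Ek]]]; last by exists k.
  by exists k => //; exists k => /=.
have cvgF : P (F n) @[n --> \oo] --> P (\bigcup_n F n).
  apply: nondecreasing_cvg_mu => //; first exact: bigcupT_measurable.
  move=> i j leij; apply/subsetPset => w [k /= ltki Ek]; exists k => //=.
  exact: leq_trans ltki _.
apply: cvge_le cvgF; apply: nearW => n.
apply: (le_trans (kolmogorov_maximal eps0 (fun k _ => Voo k))).
apply: lee_wpmul2l; first by rewrite lee_fin invr_ge0 exprn_ge0// ltW.
apply: le_trans (tail_ge (m + n)%N).
rewrite (big_addn 0 _ m) addKn big_mkord.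
by under eq_bigr do rewrite addnC.
Qed.

End centered_variables.

(** * Oscillation of the centered sums *)

(** The supremum exceeds [x] exactly when one of countably many functions does. *)
Lemma measurable_ereal_sup_image2 (d : measure_display) (T : measurableType d)
    (R : realType) (f : nat -> nat -> T -> \bar R) (A B : set nat) :
  (forall k n, measurable_fun setT (f k n)) ->
  measurable_fun setT
    (fun w => ereal_sup [set f k n w | k in A & n in B]).
Proof.
move=> mf _; apply: (measurability _ (ErealGenOInfty.measurableE R)) => //.
move=> _ [_ [x ->] <-]; rewrite setTI.
have -> : (fun w => ereal_sup [set f k n w | k in A & n in B]) @^-1`
      `]x%:E, +oo[ =
    \bigcup_(k in A) \bigcup_(n in B) (f k n @^-1` `]x%:E, +oo[).
  apply/seteqP; split => w /=.
    rewrite in_itv/= andbT => /ereal_sup_gt[_ [k Ak [n Bn <-]] ltxf].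
    by exists k => //; exists n => //=; rewrite in_itv/= andbT.
  case=> k Ak [n Bn] /=; rewrite !in_itv/= !andbT => /lt_le_trans; apply.
  by apply: ereal_sup_ubound; exists k => //; exists n.
apply: bigcup_measurable => k _; apply: bigcup_measurable => n _.
by rewrite -[X in measurable X]setTI; apply: mf => //; exact: emeasurable_itv.
Qed.

Lemma centered_sum_split (d : measure_display) (T : measurableType d)
    (R : realType) (X : nat -> {mfun T >-> R}) (P : probability T R)
    (m k : nat) (w : T) :
  (m <= k)%N ->
  centered_sum X P k w = \sum_(i < m) centered P X i w +
    \sum_(i < k.+1 - m) centered P X (m + i) w.
Proof.
move=> lemk; rewrite /centered_sum.
rewrite -(big_mkord xpredT (fun i => X i w - fine 'E_P[X i])).
rewrite (big_cat_nat _ (leqW lemk))//= big_mkord; congr (_ + _).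
rewrite (big_addn 0 _ m) big_mkord.
by apply: eq_bigr => i _; rewrite addnC.
Qed.

(** Two centered sums beyond time [m] share their first [m] terms, so that they
    differ by two partial sums of the block starting at [m].  The thirds leave
    room for a strict inequality after taking the supremum. *)
Lemma oscillation_sub_maximal (d : measure_display) (T : measurableType d)
    (R : realType) (X : nat -> {mfun T >-> R}) (P : probability T R)
    (m : nat) (eps : R) :
  0 < eps ->
  [set w | (eps%:E <=
     ereal_sup [set `|centered_sum X P k w - centered_sum X P n w|%:E
               | k in [set k | (m <= k)%N] & n in [set n | (m <= n)%N]])%E]
  `<=` \bigcup_k [set w | eps / 3 <= `|\sum_(i < k) centered P X (m + i) w|].
Proof.
move=> eps0 w /= osc; apply: contrapT => small.
have lt3 k : `|\sum_(i < k) centered P X (m + i) w| < eps / 3.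
  by rewrite ltNge; apply/negP => ge3; apply: small; exists k.
move: osc; apply/negP; rewrite -ltNge.
apply: (@le_lt_trans _ _ (eps / 3 + eps / 3)%:E); last by rewrite lte_fin; lra.
apply: ge_ereal_sup => _ [k lemk [n lemn <-]]; rewrite lee_fin.
rewrite !(centered_sum_split _ _ _ (m := m))// opprD addrACA subrr add0r.
apply: (le_trans (ler_normB _ _)).
by apply: lerD; exact: ltW.
Qed.

Unset Implicit Arguments.

Theorem theorem3 (d : measure_display) (T : measurableType d) (R : realType)
    (PP : set (probability T R)) (X : nat -> {mfun T >-> R})
    (X_integrable : forall P, PP P ->
       forall i, P.-integrable [set: T] (EFin \o X i))
    (X_independent : forall P, PP P -> independent_rvs P X)
    (X_var : ereal_sup [set (\sum_(m <= k <oo) 'V_P[X k])%E | P in PP]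
               @[m --> \oo] --> 0%E) :
  uniformly_cauchy PP (centered_sum X).
Proof.
move=> eps eps0.
have eps30 : 0 < eps / 3 by rewrite divr_gt0.
(* The supremum of an empty family is -oo, which does not tend to 0: the
   collection of measures is thus nonempty, as the lower bound 0 requires. *)
have [P0 PP0] : PP !=set0.
  apply/set0P/eqP => PP0.
  pose V (m : nat) := ereal_sup [set (\sum_(m <= k <oo) 'V_P[X k])%E | P in PP].
  have VE : V = cst -oo%E.
    by apply/funext => m; rewrite /V PP0 image_set0 ereal_sup0.
  have := cvg_lim (@ereal_hausdorff R) (X_var : V @ \oo --> 0%E).
  by rewrite VE lim_cst// => eqNy0; have := ltNyr (0 : R); rewrite eqNy0 ltxx.
have cvgV := cvgeZl (y := ((eps / 3) ^- 2)%:E) isT X_var.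
rewrite mule0 in cvgV.
apply: (squeeze_cvge _ (cvg_cst 0%E) cvgV).
apply: nearW => m; apply/andP; split.
  by apply: le_ereal_sup_tmp; eexists; [exists P0; [exact: PP0|reflexivity]|].
apply: ge_ereal_sup => _ [P PPP <-].
have iX := X_integrable P PPP.
have mS n : measurable_fun setT (centered_sum X P n).
  by apply: measurable_sum => i; exact: measurable_funB.
apply: (@le_trans _ _ (P (\bigcup_k [set w |
    eps / 3 <= `|\sum_(i < k) centered P X (m + i) w|]))).
  apply: le_measure; rewrite ?inE; last exact: oscillation_sub_maximal.
  - rewrite -[X in measurable X]setTI; apply: emeasurable_fun_c_infty => //.
    apply: measurable_ereal_sup_image2 => k n; apply/measurable_EFinP.
    by apply: measurableT_comp => //; exact: measurable_funB.
  - apply: bigcup_measurable => k _; rewrite -[X in measurable X]setTI.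
    apply: measurable_fun_le => //; apply: measurableT_comp => //.
    by apply: measurable_sum => i; exact: measurable_centered.
apply: (le_trans (kolmogorov_maximal_tail iX (X_independent P PPP) m eps30)).
apply: lee_wpmul2l; first by rewrite lee_fin invr_ge0 exprn_ge0// ltW.
by apply: ereal_sup_ubound; exists P.
Qed.
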